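(* $$\sum_{\lambda\in\mathcal{P}}\ \prod_{i\ge 1}\begin{bmatrix}\lambda_i-\lambda_{i+2}+1\\ \lambda_{i+1}-\lambda_{i+2}\end{bmatrix}_q t^{\frac{\lambda_1(\lambda_1-1)}{2}+|\lambda|}=\prod_{i\ge 1}\frac{1}{(1-t^{2i-1})(1-qt^{2i})}.$$
   Context: $\mathcal{P}$ is the set of all partitions $\lambda=(\lambda_1,\lambda_2,\ldots,\lambda_r)$, $\lambda_1\ge\lambda_2\ge\cdots\ge\lambda_r$ (including the empty partition), with $|\lambda|=\sum_{i=1}^r\lambda_i$ and the convention $\lambda_k=0$ for $k>r$. The $q$-binomial coefficients are $$\begin{bmatrix}M\\N\end{bmatrix}_q=\frac{\prod_{i=1}^M(1-q^i)}{\prod_{i=1}^N(1-q^i)\prod_{i=1}^{M-N}(1-q^i)}.$$ *)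

(* Defs.v *)
From HB Require Import structures.
From mathcomp Require Import all_boot all_order all_algebra.
From mathcomp Require Import finmap.
From mathcomp Require Import boolp.

Set Implicit Arguments.
Unset Strict Implicit.
Unset Printing Implicit Defensive.

Import GRing.Theory.
Local Open Scope ring_scope.

(* Formal power series in one variable over [R], given by their coefficients. *)
Record fps (R : Type) := Fps { fcoef : nat -> R }.

HB.instance Definition _ (R : Type) := gen_eqMixin (fps R).
HB.instance Definition _ (R : Type) := gen_choiceMixin (fps R).

Lemma fpsP (R : Type) (f g : fps R) :
  (forall n, fcoef f n = fcoef g n) -> f = g.
Proof. by case: f => f; case: g => g /= /funext->. Qed.

Section FpsRing.
Variable R : comNzRingType.
Implicit Types (f g h : fps R) (n : nat).

Definition fpsC (c : R) : fps R := Fps (fun n => if n == 0%N then c else 0).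
Definition fpsX : fps R := Fps (fun n => (n == 1%N)%:R).
Definition fps_add f g := Fps (fun n => fcoef f n + fcoef g n).
Definition fps_opp f := Fps (fun n => - fcoef f n).
Definition fps_mul f g :=
  Fps (fun n => \sum_(i < n.+1) fcoef f i * fcoef g (n - i)).

Fact fps_addA : associative fps_add.
Proof. by move=> f g h; apply: fpsP => n /=; rewrite addrA. Qed.
Fact fps_addC : commutative fps_add.
Proof. by move=> f g; apply: fpsP => n /=; rewrite addrC. Qed.
Fact fps_add0 : left_id (fpsC 0) fps_add.
Proof. by move=> f; apply: fpsP => n /=; rewrite if_same add0r. Qed.
Fact fps_addN : left_inverse (fpsC 0) fps_opp fps_add.
Proof. by move=> f; apply: fpsP => n /=; rewrite if_same addNr. Qed.

HB.instance Definition _ :=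
  GRing.isZmodule.Build (fps R) fps_addA fps_addC fps_add0 fps_addN.

Definition fps_trunc m f : {poly R} := \poly_(i < m) fcoef f i.

Lemma fcoef_mul_trunc m f g n : (n < m)%N ->
  fcoef (fps_mul f g) n = (fps_trunc m f * fps_trunc m g)`_n.
Proof.
move=> nm; rewrite coefM; apply: eq_bigr => i _.
by rewrite !coef_poly (leq_ltn_trans (leq_ord i) nm)
  (leq_ltn_trans (leq_subr _ _) nm).
Qed.

Fact fps_mulC : commutative fps_mul.
Proof.
by move=> f g; apply: fpsP => n; rewrite !(fcoef_mul_trunc _ _ (ltnSn n)) mulrC.
Qed.

Fact fps_mulA : associative fps_mul.
Proof.
move=> f g h; apply: fpsP => n.
transitivity ((fps_trunc n.+1 f * fps_trunc n.+1 g * fps_trunc n.+1 h)`_n).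
  rewrite -mulrA coefM; apply: eq_bigr => i _.
  by rewrite coef_poly ltn_ord (fcoef_mul_trunc _ _ (leq_ltn_trans (leq_subr i n) (ltnSn n))).
rewrite coefM; apply: eq_bigr => i _.
by rewrite coef_poly ltnS leq_subr (fcoef_mul_trunc _ _ (ltn_ord i)).
Qed.

Fact fps_mul1 : left_id (fpsC 1) fps_mul.
Proof.
move=> f; apply: fpsP => n /=; rewrite big_ord_recl /= mul1r subn0.
by rewrite big1 ?addr0 // => i _; rewrite mul0r.
Qed.

Fact fps_mulDl : left_distributive fps_mul fps_add.
Proof.
move=> f g h; apply: fpsP => n /=; rewrite -big_split.
by apply: eq_bigr => i _; rewrite mulrDl.
Qed.

Fact fps_1_neq0 : fpsC 1 != 0.
Proof.
by apply/eqP => /(congr1 (fun f => fcoef f 0%N)) /= /eqP; rewrite oner_eq0.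
Qed.

HB.instance Definition _ := GRing.Zmodule_isComNzRing.Build (fps R)
  fps_mulA fps_mulC fps_mul1 fps_mulDl fps_1_neq0.

(* The inverse of a non-unit is itself; [fps_unit_sub_CXn] and
   [fps_unit_sub_Xn] below provide the units. *)
Definition fps_unit f : bool := `[< exists g, g * f = 1 >].
Definition fps_inv f : fps R :=
  if pselect (exists g, g * f = 1) is left ex then projT1 (cid ex) else f.

Fact fps_mulVf : {in fps_unit, left_inverse 1 fps_inv *%R}.
Proof.
move=> f /asboolP fU; rewrite /fps_inv; case: pselect => // ex.
exact: projT2 (cid ex).
Qed.
Fact fps_unitPl f g : g * f = 1 -> fps_unit f.
Proof. by move=> gf; apply/asboolP; exists g. Qed.
Fact fps_inv_out : {in [predC fps_unit], fps_inv =1 id}.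
Proof.
by move=> f /asboolPn fNU; rewrite /fps_inv; case: pselect.
Qed.

HB.instance Definition _ := GRing.ComNzRing_hasMulInverse.Build (fps R)
  fps_mulVf fps_unitPl fps_inv_out.

Lemma fcoef0 n : fcoef (0 : fps R) n = 0.
Proof. exact: if_same. Qed.
Lemma fcoef1 n : fcoef (1 : fps R) n = (n == 0%N)%:R.
Proof. by rewrite /=; case: eqP. Qed.
Lemma fcoefD f g n : fcoef (f + g) n = fcoef f n + fcoef g n.
Proof. by []. Qed.
Lemma fcoefN f n : fcoef (- f) n = - fcoef f n.
Proof. by []. Qed.
Lemma fcoefM f g n :
  fcoef (f * g) n = \sum_(i < n.+1) fcoef f i * fcoef g (n - i).
Proof. by []. Qed.

Lemma fcoef_mulX f n :
  fcoef (fpsX * f) n = if n is n'.+1 then fcoef f n' else 0.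
Proof.
rewrite fcoefM big_ord_recl /= mul0r add0r; case: n => [|n]; first by rewrite big_ord0.
rewrite big_ord_recl /= mul1r subSS subn0 big1 ?addr0 // => i _.
by rewrite mul0r.
Qed.

Lemma fcoef_mulXn f k n :
  fcoef (fpsX ^+ k * f) n = if (n < k)%N then 0 else fcoef f (n - k).
Proof.
elim: k n => [|k IHk] n; first by rewrite expr0 mul1r subn0.
by rewrite exprS -mulrA fcoef_mulX; case: n => // n; rewrite IHk ltnS subSS.
Qed.

Lemma fcoef_mulC c f n : fcoef (fpsC c * f) n = c * fcoef f n.
Proof.
rewrite fcoefM big_ord_recl /= subn0 big1 ?addr0 // => i _.
by rewrite mul0r.
Qed.

Lemma fps_unit_sub_CXn c k : (0 < k)%N -> (1 - fpsC c * fpsX ^+ k) \is a GRing.unit.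
Proof.
move=> k0; pose g := Fps (fun n => if (k %| n)%N then c ^+ (n %/ k) else 0).
apply/unitrPr; exists g; apply: fpsP => n.
rewrite mulrBl mul1r -mulrA fcoefD fcoefN fcoef_mulC fcoef_mulXn fcoef1 /=.
case: ltnP => [nk | kn].
  rewrite mulr0 subr0; case: n nk => [|n] nk; first by rewrite dvdn0 div0n.
  by rewrite gtnNdvd.
rewrite -{1 2}(subnK kn) dvdn_addl // divnDr // divnn k0 addn1 exprS.
rewrite gtn_eqF ?(leq_trans k0) //.
by case: ifP => _; rewrite ?mulr0 subrr.
Qed.

Lemma fps_unit_sub_Xn k : (0 < k)%N -> (1 - fpsX ^+ k) \is a GRing.unit.
Proof. by move=> k0; rewrite -[fpsX ^+ k]mul1r; apply: (fps_unit_sub_CXn 1). Qed.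

(* Convergence in the product topology of [R^nat], [R] being discrete: each
    coefficient is eventually constant, along the directed set of finite subsets
    of [I] for [fps_has_sum], and along [M] in [\prod_(1 <= i <= M) f i] for
    [fps_has_prod]. *)

Definition fps_has_sum (I : choiceType) (f : I -> fps R) (s : fps R) : Prop :=
  forall n, exists A : {fset I}, forall B : {fset I}, (A `<=` B)%fset ->
    fcoef (\sum_(i <- B) f i) n = fcoef s n.

Definition fps_has_prod (f : nat -> fps R) (p : fps R) : Prop :=
  forall n, exists N, forall M, (N <= M)%N ->
    fcoef (\prod_(1 <= i < M.+1) f i) n = fcoef p n.

Lemma fps_has_sum_unique (I : choiceType) (f : I -> fps R) s s' :
  fps_has_sum f s -> fps_has_sum f s' -> s = s'.
Proof.
move=> hs hs'; apply: fpsP => n.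
have [A hA] := hs n; have [A' hA'] := hs' n.
by rewrite -(hA _ (fsubsetUl A A')) (hA' _ (fsubsetUr A A')).
Qed.

Lemma fps_has_prod_unique (f : nat -> fps R) p p' :
  fps_has_prod f p -> fps_has_prod f p' -> p = p'.
Proof.
move=> hp hp'; apply: fpsP => n.
have [N hN] := hp n; have [N' hN'] := hp' n.
by rewrite -(hN _ (leq_maxl N N')) (hN' _ (leq_maxr N N')).
Qed.

End FpsRing.

Arguments fpsX {R}.

Definition is_intpart (s : seq nat) : bool := sorted geq s && (0%N \notin s).

Record intpart := IntPart { parts :> seq nat; _ : is_intpart parts }.

HB.instance Definition _ := [isSub for parts].
HB.instance Definition _ := [Choice of intpart by <:].

(* Parts are numbered from 1, with [part l k = 0] for [k > size l]. *)
Definition part (l : intpart) (k : nat) : nat := nth 0%N l k.-1.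

Definition weight (l : intpart) : nat := sumn l.

(* Only meaningful for [N <= M], as [M - N] is truncated, and when
   [q ^+ i != 1] for [0 < i <= M]. *)
Definition qbinom (F : fieldType) (q : F) (M N : nat) : F :=
  (\prod_(1 <= i < M.+1) (1 - q ^+ i)) /
  ((\prod_(1 <= i < N.+1) (1 - q ^+ i)) *
   (\prod_(1 <= i < (M - N).+1) (1 - q ^+ i))).

Definition part_factor (F : fieldType) (q : F) (l : intpart) (i : nat) : F :=
  qbinom q (part l i - part l i.+2 + 1) (part l i.+1 - part l i.+2).

(* The product over all [i >= 1]: its factors are 1 for [i > size l], see
   [part_prodE]. *)
Definition part_prod (F : fieldType) (q : F) (l : intpart) : F :=
  \prod_(1 <= i < (size l).+1) part_factor q l i.

Lemma part_factor1 (F : fieldType) (q : F) (l : intpart) i :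
  1 - q != 0 -> (size l < i)%N -> part_factor q l i = 1.
Proof.
move=> q1 li; have p0 k : (i <= k)%N -> part l k = 0%N.
  by case: k => [|k] ik; [case: i li ik | rewrite /part nth_default // -ltnS (leq_trans li)].
rewrite /part_factor !p0 ?leqW // /qbinom !big_nat1 big_geq //.
by rewrite mul1r divff.
Qed.

Lemma part_prodE (F : fieldType) (q : F) (l : intpart) m :
  1 - q != 0 -> (size l <= m)%N ->
  \prod_(1 <= i < m.+1) part_factor q l i = part_prod q l.
Proof.
move=> q1 lm; rewrite (big_cat_nat (n := (size l).+1)) //=.
rewrite [X in _ * X]big_nat_cond [X in _ * X]big1 ?mulr1 // => i.
by rewrite andbT => /andP[li _]; apply: part_factor1.
Qed.

(* Main.v *)
(* Write [la = (d, l_2, l_3, ...)], [s = l_2 - l_3 + l_4 - ...],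
   [w = s (d + 1 - s) + l_3 + l_5 + ...], and let [k] be [d - 2 s] if
   [2 s <= d], and [2 s - d - 1] otherwise.  The exponent of [t] is then
   [2 w + k (k + 1) / 2], and the point is that the sum of the weights over the
   partitions with given [k] and [w] does not depend on [k].

   To pass from [k] to [k + 1], put [f_0 = D + 1], fix [f_1 >= f_2 >= ...], and let
   the [g_i] vary with [f_0 >= g_1 >= f_1 >= g_2 >= ...]: this runs over the
   partitions [(D, g_1, f_1, g_2, ...)] and, when [g_1 = D + 1],
   [(D + 1, f_1, g_2, ...)].  With [x_i = g_i - f_i] and [y_i = f_(i-1) - g_i],
   the weight couples [x_i] and [y_(i+1)] through
   [(q)_(x+y+1) / ((q)_x (q)_(x+1) (q)_y (q)_(y+1))], which q-Vandermonde expands as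
   [\sum_j q^(j(j+1)) / ((q)_j (q)_(j+1) (q)_(x-j) (q)_(y-j))]; after this expansion
   the symmetry between [\sum_i x_i] and [\sum_i y_i] is visible.

   For [k >= w] only the partitions [(k, f_1, f_1, f_2, f_2, ...)] remain, and they
   give [\prod_i 1 / ((1 - t^(2i)) (1 - q t^(2i)))]; Gauss' product for
   [\sum_k t^(k(k+1)/2)] finishes the proof. *)

Require Import Defs.
From HB Require Import structures.
From mathcomp Require Import all_boot all_order all_algebra.
From mathcomp Require Import finmap boolp ring zify.

Set Implicit Arguments.
Unset Strict Implicit.
Unset Printing Implicit Defensive.

Import GRing.Theory.
Local Open Scope ring_scope.

(** * q-Vandermonde *)
Section QBinomial.
Variables (F : fieldType) (q : F).
Hypothesis hq : forall i : nat, (0 < i)%N -> q ^+ i != 1.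

Definition qfact n : F := \prod_(1 <= i < n.+1) (1 - q ^+ i).

Lemma qfact0 : qfact 0 = 1.
Proof. by rewrite /qfact big_geq. Qed.

Lemma qfactS n : qfact n.+1 = qfact n * (1 - q ^+ n.+1).
Proof. by rewrite /qfact big_nat_recr. Qed.

Lemma subqX_neq0 n : 1 - q ^+ n.+1 != 0.
Proof. by rewrite subr_eq0 eq_sym hq. Qed.

Lemma qfact_neq0 n : qfact n != 0.
Proof.
by elim: n => [|n IHn]; rewrite ?qfact0 ?oner_eq0 // qfactS mulf_neq0 ?subqX_neq0.
Qed.

Lemma qbinomE n k : qbinom q n k = qfact n / (qfact k * qfact (n - k)).
Proof. by []. Qed.

Lemma qbinom_n0 n : qbinom q n 0 = 1.
Proof. by rewrite qbinomE qfact0 subn0 mul1r divff ?qfact_neq0. Qed.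

Lemma qbinom_nn n : qbinom q n n = 1.
Proof. by rewrite qbinomE subnn qfact0 mulr1 divff ?qfact_neq0. Qed.

(** [qbinom q n k] is nonzero for [k > n], where [n - k] is truncated; the value 0 there makes the
    q-Pascal rules hold for all [n] and [k]. *)
Definition gauss_binom n k : F := if (k <= n)%N then qbinom q n k else 0.

Lemma gauss_binomS n k : gauss_binom n.+1 k.+1 = gauss_binom n k + q ^+ k.+1 * gauss_binom n k.+1.
Proof.
rewrite /gauss_binom ltnS; case: ltngtP => [kn|nk|->]; last first.
- by rewrite !qbinom_nn mulr0 addr0.
- by rewrite mulr0 addr0.
have -> : n = (k.+1 + (n - k.+1))%N by rewrite subnKC.
move: (n - k.+1)%N => m; rewrite !qbinomE.
have -> : ((k.+1 + m).+1 - k.+1 = m.+1)%N by lia.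
have -> : (k.+1 + m - k = m.+1)%N by lia.
have -> : (k.+1 + m - k.+1 = m)%N by lia.
rewrite addSn (qfactS (k + m).+1) (qfactS k) (qfactS m).
have -> : q ^+ (k + m).+2 = q ^+ k.+1 * q ^+ m.+1 by rewrite -exprD; congr (_ ^+ _); lia.
have := subqX_neq0 k; have := subqX_neq0 m.
move: (qfact_neq0 m) (qfact_neq0 k) (q ^+ k.+1) (q ^+ m.+1) => /= h1 h2 a b h3 h4.
by field; rewrite h1 h2 h3 h4.
Qed.

Lemma gauss_binomS_r n k :
  gauss_binom n.+1 k.+1 = gauss_binom n k.+1 + q ^+ (n - k) * gauss_binom n k.
Proof.
rewrite /gauss_binom ltnS; case: ltngtP => [kn|nk|->]; last first.
- by rewrite !qbinom_nn subnn expr0 mulr1 add0r.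
- by rewrite mulr0 addr0.
have -> : n = (k.+1 + (n - k.+1))%N by rewrite subnKC.
move: (n - k.+1)%N => m; rewrite !qbinomE.
have -> : ((k.+1 + m).+1 - k.+1 = m.+1)%N by lia.
have -> : (k.+1 + m - k = m.+1)%N by lia.
have -> : (k.+1 + m - k.+1 = m)%N by lia.
rewrite addSn (qfactS (k + m).+1) (qfactS k) (qfactS m).
have -> : q ^+ (k + m).+2 = q ^+ k.+1 * q ^+ m.+1 by rewrite -exprD; congr (_ ^+ _); lia.
have := subqX_neq0 k; have := subqX_neq0 m.
move: (qfact_neq0 m) (qfact_neq0 k) (q ^+ k.+1) (q ^+ m.+1) => /= h1 h2 a b h3 h4.
by field; rewrite h1 h2 h3 h4.
Qed.

(** Induction on [y] for all [i]: one q-Pascal rule splits the right side into the instances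
    [(y, i)] and [(y, i + 1)], the other splits the binomial in [y] on the left. *)
Lemma q_vandermonde a i y p : (y <= p)%N ->
  \sum_(j < p.+1) q ^+ (j * (j + i)) * gauss_binom a (j + i) * gauss_binom y j =
  gauss_binom (a + y) (y + i).
Proof.
elim: y i p => [|y IHy] i p yp.
  rewrite big_ord_recl big1 /= => [|j _].
    by rewrite addr0 /gauss_binom /= qbinom_n0 mulr1 mul1r addn0 add0n.
  by rewrite {2}/gauss_binom mulr0.
case: p yp => // p yp; rewrite addnS addSn gauss_binomS -(IHy i p.+1 (leqW yp)).
rewrite -addnS -(IHy i.+1 p yp).
rewrite big_ord_recl [in RHS]big_ord_recl /= mulr_sumr -addrA -big_split /=.
congr (_ + _); first by rewrite /gauss_binom !qbinom_n0.
apply: eq_bigr => j _; rewrite /bump /= add1n gauss_binomS_r mulrDr; congr (_ + _).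
case: (leqP j y) => [jy | yj]; last by rewrite {2 4}/gauss_binom leqNgt yj !mulr0.
rewrite addSnnS !mulrA; congr (_ * _); rewrite mulrAC; congr (_ * _).
by rewrite -!exprD; congr (_ ^+ _); nia.
Qed.

(* [1/(q)_{n-k}], with the convention that it vanishes for [k > n]. *)
Definition qrec n k : F := if (k <= n)%N then (qfact (n - k))^-1 else 0.

Definition qcoupling j : F := q ^+ (j * j.+1) / (qfact j * qfact j.+1).

(** q-Vandermonde with [a = x + 1] and [i = 1], divided by $(q)_{x+1} (q)_y$. *)
Lemma qfact_coupling x y p : (y <= p)%N ->
  qfact (x + y).+1 / (qfact x * qfact x.+1 * (qfact y * qfact y.+1)) =
  \sum_(j < p.+1) qcoupling j * qrec x j * qrec y j.
Proof.
move=> yp; have := q_vandermonde x.+1 1 yp.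
rewrite {3}/gauss_binom addSn addn1 ltnS leq_addl qbinomE subSS addnK => h.
have [nx nx1 ny ny1] :=
  And4 (qfact_neq0 x) (qfact_neq0 x.+1) (qfact_neq0 y) (qfact_neq0 y.+1).
transitivity (qfact (x + y).+1 / (qfact y.+1 * qfact x) / (qfact x.+1 * qfact y)).
  by field; rewrite nx nx1 ny ny1.
rewrite -h mulr_suml; apply: eq_bigr => j _.
rewrite /gauss_binom /qrec /qcoupling addn1 ltnS.
case: leqP => [jx|]; case: leqP => [jy|]; rewrite ?(mulr0, mul0r) //.
rewrite !qbinomE subSS.
have [n1 n2 n3 n4] := And4 (qfact_neq0 (x - j)) (qfact_neq0 (y - j))
  (qfact_neq0 j) (qfact_neq0 j.+1).
by field; rewrite nx1 ny n1 n2 n3 n4.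
Qed.

End QBinomial.

(** * Symmetry of the interlacing sums *)
Section PairSum.
Variables (F : fieldType) (q : F).
Hypothesis hq : forall i : nat, (0 < i)%N -> q ^+ i != 1.

Implicit Types psi : nat -> nat -> nat -> F.

Definition pair_shift x y f psi X Y O := psi (x + X)%N (y + Y)%N (f + O)%N.

(* Sum over [p = f_0 >= g_1 >= f_1 >= ... >= g_L >= f_L = 0] of the weights of the
   successive parts, [x] being the last [g_0 - f_0]; [psi] is applied to
   [\sum_i (g_i - f_i)], [\sum_i (f_(i-1) - g_i)] and [\sum_i f_i]. *)
Fixpoint pair_sum L p x psi : F :=
  if L is L'.+1 then
    \sum_(f < p.+1) \sum_(x' < (p - f).+1)
      qbinom q (x + (p - f - x')).+1 (p - f - x') * qbinom q (p - f).+1 x' *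
      pair_sum L' f x' (pair_shift x' (p - f - x') f psi)
  else (p == 0%N)%:R * psi 0%N 0%N 0%N.

Lemma eq_pair_sum L p x psi psi' :
  (forall X Y O, X + Y = p -> psi X Y O = psi' X Y O)%N ->
  pair_sum L p x psi = pair_sum L p x psi'.
Proof.
elim: L p x psi psi' => [|L IHL] p x psi psi' h /=.
  by case: eqP => [p0|_]; rewrite ?mul0r // h.
apply: eq_bigr => f _; apply: eq_bigr => x' _; congr (_ * _).
by apply: IHL => X Y O XY; apply: h; have := ltn_ord f; have := ltn_ord x'; lia.
Qed.

(** What a step of [pair_sum] becomes once the coupling is expanded, [j] being the expansion index.
    The prefactor [h] is free because [pair_dual] and [class_sum] use different ones. *)
Definition dual_step L (h : nat -> F) p j psi : F :=
  \sum_(f < p.+1) h f * \sum_(x < (p - f).+1)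
    qrec q (p - f - x) j / qfact q x *
    pair_sum L f x (pair_shift x (p - f - x) f psi).

Definition pair_dual L p j psi : F :=
  if L is L'.+1 then dual_step L' (fun f => qfact q (p - f).+1) p j psi
  else ((p == 0%N) && (j == 0%N))%:R * qfact q 1 * psi 0%N 0%N 0%N.

(** The binomials of the first step couple [x] to [z = p - f - y] as in [qfact_coupling]; after
    expansion [x] occurs only in [qfact q x] and [qrec q x j]. *)
Lemma pair_sum_dual L p x psi :
  pair_sum L p x psi =
  qfact q x * \sum_(j < p.+1) qcoupling q j * qrec q x j * pair_dual L p j psi.
Proof.
case: L => [|L] /=.
  rewrite big_ord_recl /= [X in _ + X]big1 => [|j _]; last by rewrite andbF !mul0r mulr0.
  rewrite andbT /qcoupling /qrec mul0n subn0 expr0 qfact0 addr0 mul1r.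
  have [n1 nx] := (qfact_neq0 hq 1, qfact_neq0 hq x).
  rewrite leq0n; by field; rewrite n1 nx.
rewrite /dual_step [in RHS]mulr_sumr.
under [in RHS]eq_bigr => j _ do rewrite !mulr_sumr.
rewrite exchange_big /=; apply: eq_bigr => f _.
under [in RHS]eq_bigr => j _ do rewrite !mulr_sumr.
rewrite exchange_big /=; apply: eq_bigr => y _.
set z := (p - f - y)%N; set P := pair_sum _ _ _ _.
have zp : (z <= p)%N by rewrite /z; lia.
transitivity (qfact q x * qfact q (p - f).+1 / qfact q y * P *
   \sum_(j < p.+1) qcoupling q j * qrec q x j * qrec q z j); last first.
  by rewrite mulr_sumr; apply: eq_bigr => j _; ring.
rewrite -(qfact_coupling hq x zp) !qbinomE.
have yf : (y <= p - f)%N by rewrite -ltnS.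
have -> : ((p - f).+1 - y = z.+1)%N by rewrite /z; lia.
have -> : ((x + z).+1 - z = x.+1)%N by lia.
have [n1 n2 n3 n4 n5] := And5 (qfact_neq0 hq x) (qfact_neq0 hq x.+1)
  (qfact_neq0 hq y) (qfact_neq0 hq z) (qfact_neq0 hq z.+1).
by field; rewrite n1 n2 n3 n4 n5.
Qed.

(** The factors [qrec] confine [x] to [j' <= x <= N - j]; with [x = j' + i] the weight is symmetric
    under [i -> N - (j + j') - i]. *)
Lemma sum_qrec_qrec N j j' (G : nat -> F) :
  \sum_(x < N.+1) qrec q (N - x) j * qrec q x j' * G x =
  if (j + j' <= N)%N then
    \sum_(i < (N - (j + j')).+1)
      (qfact q (N - (j + j') - i))^-1 / qfact q i * G (j' + i)%N
  else 0.
Proof.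
case: leqP => jN; last first.
  rewrite big1 // => x _; rewrite /qrec.
  case: (leqP j (N - x)) => h1; rewrite ?mul0r //.
  case: (leqP j' x) => h2; rewrite ?(mulr0, mul0r) //.
  by exfalso; have := ltn_ord x; lia.
rewrite -(big_mkord xpredT (fun x => qrec q (N - x) j * qrec q x j' * G x)).
rewrite (big_cat_nat (n := j')) //=; last by lia.
rewrite big_nat big1 ?add0r => [|x]; last first.
  by rewrite /qrec => /andP[_ xj]; rewrite [(j' <= x)%N]leqNgt xj mulr0 mul0r.
rewrite (big_cat_nat (n := (j' + (N - (j + j')).+1)%N)) /=; [|lia|lia].
rewrite [X in _ + X]big_nat [X in _ + X]big1 ?addr0 => [|x]; last first.
  move=> /andP[xj xN]; rewrite /qrec; case: leqP; rewrite ?mul0r //; lia.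
rewrite -{1}[j']addn0 addnC [(j' + _)%N]addnC big_addn addnK big_mkord.
apply: eq_bigr => i _; rewrite /qrec leq_addl addnK [(j' + i)%N]addnC.
have iN : (i <= N - (j + j'))%N by rewrite -ltnS.
have -> : (j <= N - (i + j'))%N by lia.
by congr (_^-1 / _ * _); congr qfact; lia.
Qed.

(** Expanding the inner [pair_sum] gives [psi] the arguments [j + i + (j' + X)] and [j + m + Y] with
    [i + m = N - (j + j')]. The hypothesis swaps [j' + X] with [Y], and reversing the sum swaps [i]
    with [m]. *)
Lemma dual_step_sym L h p j psi :
  (forall p' j' psi',
    pair_dual L p' j' (fun X Y O => psi' (j' + X)%N Y O) =
    pair_dual L p' j' (fun X Y O => psi' Y (j' + X)%N O)) ->
  dual_step L h p j (fun X Y O => psi (j + X)%N Y O) =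
  dual_step L h p j (fun X Y O => psi Y (j + X)%N O).
Proof.
move=> sym; apply: eq_bigr => f _; congr (_ * _).
have expand (phi : nat -> nat -> nat -> F) :
  \sum_(x < (p - f).+1) qrec q (p - f - x) j / qfact q x *
    pair_sum L f x (pair_shift x (p - f - x) f phi) =
  \sum_(j' < f.+1) qcoupling q j' * \sum_(x < (p - f).+1)
    qrec q (p - f - x) j * qrec q x j' *
    pair_dual L f j' (pair_shift x (p - f - x) f phi).
  under [RHS]eq_bigr => j' _ do rewrite mulr_sumr.
  rewrite exchange_big /=; apply: eq_bigr => x _.
  rewrite pair_sum_dual mulrA mulfVK ?qfact_neq0 // mulr_sumr.
  by apply: eq_bigr => j' _; ring.
rewrite !expand; apply: eq_bigr => j' _; congr (_ * _).
move: (p - f)%N => N.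
rewrite !(sum_qrec_qrec N j j' (fun x => pair_dual L f j' (pair_shift x (N - x) f _))).
case: ifP => // jN; rewrite [RHS](reindex_inj rev_ord_inj) /=.
apply: eq_bigr => i _; rewrite subSS.
have iN : (i <= N - (j + j'))%N by rewrite -ltnS.
rewrite subKn // [(qfact q i)^-1 * _]mulrC; congr (_ * _).
set m := (N - (j + j') - i)%N.
have -> : (N - (j' + i) = j + m)%N by rewrite /m; lia.
have -> : (N - (j' + m) = j + i)%N by rewrite /m; lia.
transitivity (pair_dual L f j' (fun X Y O => psi (j + i + (j' + X))%N (j + m + Y)%N (f + O)%N)).
  congr pair_dual; apply/funext => X; apply/funext => Y; apply/funext => O.
  by rewrite /pair_shift; congr psi; lia.
rewrite (sym _ _ (fun X Y O => psi (j + i + X)%N (j + m + Y)%N (f + O)%N)).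
congr pair_dual; apply/funext => X; apply/funext => Y; apply/funext => O.
by rewrite /pair_shift; congr psi; lia.
Qed.

Lemma pair_dual_sym L p j psi :
  pair_dual L p j (fun X Y O => psi (j + X)%N Y O) =
  pair_dual L p j (fun X Y O => psi Y (j + X)%N O).
Proof.
elim: L p j psi => [|L IHL] p j psi /=; last exact: dual_step_sym.
by case: j => [|j]; rewrite ?andbF ?mul0r.
Qed.

(** For [p = D + 1], the sum over both families in the passage from [k] to [k + 1]: the first
    binomial is the factor of the part [D] if $g_1 \le D$, and is 1 if $g_1 = D + 1$. *)
Definition class_sum L p psi : F :=
  \sum_(f < p.+1) \sum_(x < (p - f).+1)
    qbinom q (p - f) x * pair_sum L f x (pair_shift x (p - f - x) f psi).

Lemma class_sum_sym L p psi :
  class_sum L p psi = class_sum L p (fun X Y O => psi Y X O).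
Proof.
have E phi : class_sum L p phi = dual_step L (fun f => qfact q (p - f)) p 0 phi.
  apply: eq_bigr => f _; rewrite mulr_sumr; apply: eq_bigr => x _.
  by rewrite qbinomE /qrec leq0n subn0 invfM; ring.
by rewrite !E -(dual_step_sym _ _ 0 psi (pair_dual_sym L)).
Qed.

Lemma eq_class_sum L p psi psi' :
  (forall X Y O, X + Y = p -> psi X Y O = psi' X Y O)%N ->
  class_sum L p psi = class_sum L p psi'.
Proof.
move=> h; apply: eq_bigr => f _; apply: eq_bigr => x _; congr (_ * _).
apply: eq_pair_sum => X Y O XY; apply: h.
by have := ltn_ord f; have := ltn_ord x; lia.
Qed.

End PairSum.

(** * Sums over partitions with a given largest part *)
Section TailSum.
Variables (F : fieldType) (q : F).
Hypothesis hq : forall i : nat, (0 < i)%N -> q ^+ i != 1.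

Implicit Types phi chi : nat -> nat -> F.

(* Sum over the [b >= c_1 >= ... >= c_m = 0] of the weight of the partition
   [(a, b, c_1, c_2, ...)]; [phi] is applied to [c_1 + c_3 + ...] and
   [c_2 + c_4 + ...], which swap roles at each step. *)
Fixpoint tail_sum m a b phi : F :=
  if m is m'.+1 then
    \sum_(c < b.+1) qbinom q (a - c).+1 (b - c) *
      tail_sum m' b c (fun u v => phi (c + v)%N u)
  else (b == 0%N)%:R * phi 0%N 0%N.

Lemma tail_sumS m a b phi :
  tail_sum m.+1 a b phi =
  \sum_(c < b.+1) qbinom q (a - c).+1 (b - c) *
    tail_sum m b c (fun u v => phi (c + v)%N u).
Proof. by []. Qed.

Lemma eq_tail_sum m a b phi phi' :
  (forall u v, v <= u <= v + b -> phi u v = phi' u v)%N ->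
  tail_sum m a b phi = tail_sum m a b phi'.
Proof.
elim: m a b phi phi' => [|m IHm] a b phi phi' h /=; first by rewrite h.
apply: eq_bigr => c _; congr (_ * _); apply: IHm => u v uv.
by apply: h; have := ltn_ord c; lia.
Qed.

Lemma tail_sum0 m a b : tail_sum m a b (fun _ _ => 0) = 0.
Proof.
elim: m a b => [|m IHm] a b /=; first by rewrite mulr0.
by rewrite big1 // => c _; rewrite IHm mulr0.
Qed.

Lemma tail_sum_eq0 m a b phi :
  (forall u v, (v <= u <= v + b)%N -> phi u v = 0) -> tail_sum m a b phi = 0.
Proof. by move/eq_tail_sum->; apply: tail_sum0. Qed.

Lemma tail_sum_b0 m a phi : tail_sum m a 0 phi = phi 0%N 0%N.
Proof.
elim: m a phi => [|m IHm] a phi /=; first by rewrite mul1r.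
by rewrite big_ord1 qbinom_n0 // mul1r IHm.
Qed.

(** A chain counted on the left only has $c_m > 0$, hence $u + v \ge m$. *)
Lemma tail_sum_stable m a b phi :
  (forall u v, (m <= u + v)%N -> phi u v = 0) ->
  tail_sum m.+1 a b phi = tail_sum m a b phi.
Proof.
elim: m a b phi => [|m IHm] a b phi h.
  have -> : phi = fun _ _ => 0 by apply/funext => u; apply/funext => v; apply: h.
  by rewrite !tail_sum0.
rewrite 2!tail_sumS; apply: eq_bigr => c _; congr (_ * _).
case: (posnP c) => [-> | c0]; first by rewrite !tail_sum_b0.
by apply: IHm => u v uv; apply: h; lia.
Qed.

Lemma tail_sum_big (I : Type) (r : seq I) m a b (phi : I -> nat -> nat -> F) :
  tail_sum m a b (fun u v => \sum_(i <- r) phi i u v) =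
  \sum_(i <- r) tail_sum m a b (phi i).
Proof.
elim: m a b phi => [|m IHm] a b phi /=; first by rewrite mulr_sumr.
rewrite exchange_big /=; apply: eq_bigr => c _.
by rewrite (IHm _ _ (fun i u v => phi i (c + v)%N u)) mulr_sumr.
Qed.

Lemma tail_sumZ k m a b phi :
  tail_sum m a b (fun u v => k * phi u v) = k * tail_sum m a b phi.
Proof.
elim: m a b phi => [|m IHm] a b phi /=; first by rewrite mulrCA.
rewrite mulr_sumr; apply: eq_bigr => c _.
by rewrite (IHm _ _ (fun u v => phi (c + v)%N u)) mulrCA.
Qed.

Lemma sum_ord_triangle (G : nat -> nat -> F) p :
  \sum_(g < p.+1) \sum_(f < g.+1) G g f =
  \sum_(f < p.+1) \sum_(x < (p - f).+1) G (f + x)%N f.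
Proof.
elim: p => [|p IHp]; first by rewrite !big_ord1.
rewrite big_ord_recr /= IHp [in RHS]big_ord_recr /= subnn big_ord1 addn0.
rewrite [X in _ + X = _]big_ord_recr addrA -big_split /=; congr (_ + _).
apply: eq_bigr => f _; rewrite subSn; last by rewrite -ltnS.
rewrite [in RHS]big_ord_recr /=; congr (_ + G _ _).
by have := ltn_ord f; lia.
Qed.

Lemma tail_sum_pair L p x phi :
  tail_sum L.*2 (p + x) p phi =
  pair_sum q L p x (fun X Y O => phi (X + O)%N O).
Proof.
elim: L p x phi => [|L IHL] p x phi; first by [].
rewrite doubleS /=; under eq_bigr => g _ do rewrite mulr_sumr.
pose G g f := qbinom q (p + x - g).+1 (p - g) * (qbinom q (p - f).+1 (g - f) *
  tail_sum L.*2 g f (fun u v => phi (g + u)%N (f + v)%N)).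
rewrite (sum_ord_triangle G); apply: eq_bigr => f _; apply: eq_bigr => y _.
have yf : (y <= p - f)%N by rewrite -ltnS.
have fp : (f <= p)%N by rewrite -ltnS.
rewrite /G IHL mulrA; congr (qbinom q _ _ * qbinom q _ _ * _); [lia|lia|lia|].
congr pair_sum; apply/funext => X; apply/funext => Y; apply/funext => O.
by rewrite /pair_shift; congr phi; lia.
Qed.

(* [chi] is applied to [l_2 + l_4 + ...] and [l_3 + l_5 + ...] *)
Definition first_sum m d chi : F :=
  \sum_(b < d.+1) tail_sum m d b (fun u v => chi (b + v)%N u).

Lemma eq_first_sum m d chi chi' :
  (forall e o, o <= e <= o + d -> chi e o = chi' e o)%N ->
  first_sum m d chi = first_sum m d chi'.
Proof.
move=> h; apply: eq_bigr => b _; apply: eq_tail_sum => u v uv.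
by apply: h; have := ltn_ord b; lia.
Qed.

Lemma first_sum_stable m n d chi :
  (forall e o, (m <= e + o)%N -> chi e o = 0) -> (m <= n)%N ->
  first_sum n d chi = first_sum m d chi.
Proof.
move=> h mn; rewrite -(subnKC mn); elim: (n - m)%N => [|k IHk]; first by rewrite addn0.
rewrite -IHk addnS; apply: eq_bigr => b _; apply: tail_sum_stable => u v uv.
by apply: h; lia.
Qed.

Lemma class_sumE L D chi :
  class_sum q L D.+1 (fun X Y O => chi (X + O)%N O) =
  first_sum L.*2.+1 D chi +
  first_sum L.*2 D.+1 (fun e o => chi (D.+1 + o)%N e).
Proof.
pose G g f := qbinom q (D.+1 - f) (g - f) *
  tail_sum L.*2 g f (fun u v => chi (g + u)%N (f + v)%N).
transitivity (\sum_(g < D.+2) \sum_(f < g.+1) G g f).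
  rewrite (sum_ord_triangle G); apply: eq_bigr => f _; apply: eq_bigr => x _.
  rewrite /G tail_sum_pair addKn; congr (_ * pair_sum _ _ _ _ _).
  apply/funext => X; apply/funext => Y; apply/funext => O.
  by rewrite /pair_shift; congr chi; lia.
rewrite big_ord_recr; congr (_ + _); apply: eq_bigr => g _; last first.
  by rewrite /G qbinom_nn ?mul1r.
apply: eq_bigr => f _; rewrite /G subSn //.
by have := ltn_ord f; have := ltn_ord g => /=; lia.
Qed.

(** [class_sum_sym] exchanges [X] and [Y = D + 1 - X], where [X] is [e - o] in the first family and
    [D + 1 + o - e] in the second. *)
Lemma first_sum_flip L D (xi : nat -> nat -> F) :
  first_sum L.*2.+1 D (fun e o => xi (e - o)%N o) +
  first_sum L.*2 D.+1 (fun e o => xi (D.+1 + o - e)%N e) =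
  first_sum L.*2.+1 D (fun e o => xi (D.+1 + o - e)%N o) +
  first_sum L.*2 D.+1 (fun e o => xi (e - o)%N e).
Proof.
transitivity (class_sum q L D.+1 (fun X Y O => xi X O)).
  rewrite -(class_sumE L D (fun e o => xi (e - o)%N o)).
  by apply: eq_class_sum => X Y O XY; rewrite addnK.
rewrite class_sum_sym //.
transitivity (class_sum q L D.+1 (fun X Y O => xi (D.+1 + O - (X + O))%N O)).
  by apply: eq_class_sum => X Y O XY; congr xi; lia.
rewrite (class_sumE L D (fun e o => xi (D.+1 + o - e)%N o)); congr (_ + _).
by apply: eq_first_sum => e o eo; congr xi; lia.
Qed.

(* The sum over the partitions with largest part [d] whose remaining parts have
   alternating sum [s] and such that [w = s (d + 1 - s) + l_3 + l_5 + ...]; no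
   such partition has more than [s + 2 w + 1] parts. *)
Definition refined_sum d s w : F :=
  first_sum (s + 2 * w).+1 d
    (fun e o => ((e == s + o) && (s * (d.+1 - s) + o == w))%N%:R).

Lemma refined_sumE m d s w : (s + 2 * w < m)%N ->
  first_sum m d (fun e o => ((e == s + o) && (s * (d.+1 - s) + o == w))%N%:R) =
  refined_sum d s w.
Proof.
move=> sm; rewrite /refined_sum -(first_sum_stable (n := m) (m := (s + 2 * w).+1)) // => e o eo.
case: eqP => //= h1; case: eqP => //= h2; exfalso.
by have : (o <= w)%N; [rewrite -h2 leq_addl | lia].
Qed.

Lemma refined_sum_eq0 d s w : (d < s)%N || (w < s * (d.+1 - s))%N ->
  refined_sum d s w = 0.
Proof.
move=> h; transitivity (first_sum (s + 2 * w).+1 d (fun _ _ => 0)); last first.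
  by rewrite /first_sum big1 // => b _; rewrite tail_sum0.
apply: eq_first_sum => e o eo; case: eqP; case: eqP => //=.
case/orP: h => h; first lia.
by move=> h1 _; exfalso; move: h; rewrite -h1 ltnNge leq_addr.
Qed.

(** [xi] selects [X = r] and $w = r(D+1-r) + O$. In the second family $s = D+1-r$ and $O = s + o$,
    so this is $s(D+2-s) + o$: both families carry the same [w]. *)
Lemma refined_sum_reflect D r w : (r <= D.+1)%N ->
  refined_sum D r w + refined_sum D.+1 (D.+1 - r) w =
  refined_sum D (D.+1 - r) w + refined_sum D.+1 r w.
Proof.
move=> rD; pose L := (D + 2 * w).+2.
pose xi X O : F := ((X == r) && (r * (D.+1 - r) + O == w))%N%:R.
rewrite -!(@refined_sumE L.*2.+1 D) -?(@refined_sumE L.*2 D.+1);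
  try by rewrite /L; lia.
have := first_sum_flip L D xi; rewrite /xi => flip.
transitivity (first_sum L.*2.+1 D (fun e o => xi (e - o)%N o) +
  first_sum L.*2 D.+1 (fun e o => xi (D.+1 + o - e)%N e)).
  congr (_ + _); apply: eq_first_sum => e o eo; rewrite /xi; congr ((_ : bool)%:R).
    by congr (_ && _); lia.
  have -> : (e == D.+1 - r + o)%N = (D.+1 + o - e == r)%N by lia.
  case: eqP => //= er; congr (_ == _).
  have -> : (e = D.+1 - r + o)%N by lia.
  have -> : (D.+2 - (D.+1 - r) = r.+1)%N by lia.
  by rewrite mulnC; lia.
rewrite flip; congr (_ + _); apply: eq_first_sum => e o eo; congr ((_ : bool)%:R).
  have -> : (e == D.+1 - r + o)%N = (D.+1 + o - e == r)%N by lia.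
  by rewrite subKn // mulnC.
have -> : (e == r + o)%N = (e - o == r)%N by lia.
case: eqP => //= er; congr (_ == _).
have -> : (e = r + o)%N by lia.
have -> : (D.+2 - r = (D.+1 - r).+1)%N by lia.
by rewrite mulnS; lia.
Qed.

End TailSum.

(** * Independence of the index [k] *)
Section Branch.
Variables (F : fieldType) (q : F).
Hypothesis hq : forall i : nat, (0 < i)%N -> q ^+ i != 1.

(* The sum over the partitions with [core_index d s = k]; the index set is that of
   [sum_core_index], cut off where [refined_sum] vanishes. *)
Definition core_sum k w : F :=
  \sum_(r < w.+1) (refined_sum q (k + 2 * r) r w +
                   refined_sum q (k + 2 * r).+1 (k + r).+1 w).

(** Reflection at [D = k + 2 r] exchanges [r] and [k + r + 1]; shifting [r] by one in one half of
    the result gives [core_sum k.+1]. *)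
Lemma core_sumS k w : core_sum k.+1 w = core_sum k w.
Proof.
transitivity (\sum_(r < w.+1) (refined_sum q (k + 2 * r) (k + r).+1 w +
                              refined_sum q (k + 2 * r).+1 r w)); last first.
  apply: eq_bigr => r _; have := @refined_sum_reflect _ _ hq (k + 2 * r) r w.
  have -> : ((k + 2 * r).+1 - r = (k + r).+1)%N by lia.
  by move=> -> //; lia.
rewrite /core_sum !big_split /= addrC; congr (_ + _).
rewrite big_ord_recr [in RHS]big_ord_recl /=.
(* The shift leaves two end terms: the last has [s (d + 1 - s) > w], the first has [s > d]. *)
rewrite [refined_sum _ (k.+1 + 2 * w).+1 _ _]refined_sum_eq0; last by apply/orP; right; nia.
rewrite [refined_sum _ (k + 2 * 0) _ _]refined_sum_eq0; last by apply/orP; left; lia.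
rewrite addr0 add0r; apply: eq_bigr => r _.
by congr refined_sum; rewrite /bump; lia.
Qed.

(** By independence of [k], take [k = w]: every term but [d = w], [s = 0] then has
    [s (d + 1 - s) > w]. *)
Lemma core_sumE k w : core_sum k w = refined_sum q w 0 w.
Proof.
transitivity (core_sum w w).
  transitivity (core_sum 0 w); last by elim: {2}w => [|i ->]; rewrite ?core_sumS.
  by elim: k => [|k <-]; rewrite ?core_sumS.
rewrite /core_sum big_ord_recl big1 => [|r _] /=.
  rewrite addr0 muln0 !addn0 [X in _ + X]refined_sum_eq0 ?addr0 //.
  by apply/orP; right; nia.
rewrite !refined_sum_eq0 ?addr0 //; apply/orP; right; rewrite /bump; nia.
Qed.

Lemma core_sum_widen k w N : (w < N)%N ->
  \sum_(r < N) (refined_sum q (k + 2 * r) r w +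
                refined_sum q (k + 2 * r).+1 (k + r).+1 w) = core_sum k w.
Proof.
move=> wN; pose G r := refined_sum q (k + 2 * r) r w +
                       refined_sum q (k + 2 * r).+1 (k + r).+1 w.
rewrite /core_sum -!(big_mkord xpredT G) (big_cat_nat (n := w.+1)) //=.
rewrite [X in _ + X]big_nat [X in _ + X]big1 ?addr0 // => r /andP[wr _].
by rewrite /G !refined_sum_eq0 ?addr0 //; apply/orP; right; nia.
Qed.

Definition tri n := 'C(n.+1, 2).

Lemma mul2_tri n : (2 * tri n = n * n.+1)%N.
Proof. by rewrite /tri -mul_bin_diag /= bin1 mulnC. Qed.

Definition core_index d s := if (2 * s <= d)%N then (d - 2 * s)%N else (2 * s - d.+1)%N.

(** With [e = s + o] and [w = s (d + 1 - s) + o], this turns the exponent [tri d + e + o] into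
    [2 w + tri (core_index d s)]. *)
Lemma tri_core_index d s : (s <= d)%N ->
  (2 * (s * (d.+1 - s)) + tri (core_index d s) = tri d + s)%N.
Proof.
move=> sd; have := mul2_tri (core_index d s); have := mul2_tri d.
rewrite /core_index; case: leqP => h; move: (tri d) (tri _) => T T'.
  have [e ->] : exists e, d = (2 * s + e)%N by exists (d - 2 * s)%N; lia.
  have -> : ((2 * s + e).+1 - s = s + e + 1)%N by lia.
  have -> : (2 * s + e - 2 * s = e)%N by lia.
  by nia.
have [a [b [ds ->]]] : exists a b, (d.+1 = 2 * a + b /\ s = a + b)%N.
  by exists (d.+1 - s)%N, (2 * s - d.+1)%N; lia.
have -> : (d.+1 - (a + b) = a)%N by lia.
have -> : (2 * (a + b) - d.+1 = b)%N by lia.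
by nia.
Qed.

Lemma sum_shift (G : nat -> F) M c :
  (forall d, (M <= d)%N -> (c <= d)%N -> G d = 0) ->
  \sum_(k < M) G (k + c)%N = \sum_(d < M) if (c <= d)%N then G d else 0.
Proof.
move=> G0; pose H d := if (c <= d)%N then G d else 0.
transitivity (\sum_(0 <= d < M + c) H d).
  rewrite (big_cat_nat (n := c)) ?leq_addl //= [X in X + _]big_nat [X in X + _]big1.
    rewrite add0r -{2}[c]add0n big_addn addnK big_mkord.
    by apply: eq_bigr => k _; rewrite /H leq_addl.
  by move=> d /andP[_ dc]; rewrite /H leqNgt dc.
rewrite (big_cat_nat (n := M)) ?leq_addr //= [X in _ + X]big_nat [X in _ + X]big1.
  by rewrite addr0 big_mkord.
by move=> d /andP[Md _]; rewrite /H; case: ifP => // cd; apply: G0.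
Qed.

(* [(d, s) |-> core_index d s] has exactly the fibres
   [(k + 2 r, r)] and [(k + 2 r + 1, k + r + 1)]. *)
Lemma sum_core_index (X : nat -> nat -> F) M :
  (forall d s, (M <= d)%N -> (s <= d)%N -> X d s = 0) ->
  \sum_(d < M) \sum_(s < d.+1) X d s =
  \sum_(k < M) \sum_(r < M) (X (k + 2 * r)%N r + X (k + 2 * r).+1 (k + r).+1).
Proof.
move=> X0; under [RHS]eq_bigr => k _ do rewrite big_split /=.
rewrite big_split /=; under eq_bigr => d _.
  rewrite (bigID (fun s : 'I_d.+1 => 2 * s <= d)%N) /=; over.
rewrite big_split /=; congr (_ + _); rewrite [RHS]exchange_big /=.
  transitivity (\sum_(d < M) \sum_(r < M) if (2 * r <= d)%N then X d r else 0).
    apply: eq_bigr => d _; have dM := ltn_ord d.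
    rewrite -(big_mkord (fun s => 2 * s <= d)%N (X d)) big_mkcond.
    rewrite -(big_mkord xpredT (fun r => if (2 * r <= d)%N then X d r else 0)).
    rewrite [in RHS](big_cat_nat (n := d.+1)) //= [X in _ + X]big_nat [X in _ + X]big1 ?addr0 //.
    by move=> r /andP[dr _]; case: ifP => //; lia.
  rewrite exchange_big /=; apply: eq_bigr => r _.
  rewrite -(sum_shift (G := X^~ r)) // => d Md rd.
  by apply: X0 => //; lia.
(* The half [2 s > d] is reindexed by [r = d - s]; then [d = k + 2 r + 1] gives [s = k + r + 1]. *)
transitivity (\sum_(d < M) \sum_(r < M) if (2 * r < d)%N then X d (d - r)%N else 0).
  apply: eq_bigr => d _; have dM := ltn_ord d.
  rewrite big_mkcond (reindex_inj rev_ord_inj) /=.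
  rewrite -(big_mkord xpredT (fun r => if (2 * r < d)%N then X d (d - r)%N else 0)).
  rewrite [in RHS](big_cat_nat (n := d.+1)) //= [X in _ + X]big_nat [X in _ + X]big1 ?addr0.
    rewrite big_mkord; apply: eq_bigr => r _; rewrite subSS -ltnNge.
    by have rd := ltn_ord r; congr (if _ then _ else _); lia.
  by move=> r /andP[dr _]; case: ifP => //; lia.
rewrite exchange_big /=; apply: eq_bigr => r _.
rewrite -(sum_shift (G := fun d => X d (d - r)%N)) => [|d Md rd].
  by apply: eq_bigr => k _; rewrite addnS; congr X; lia.
by apply: X0 => //; lia.
Qed.

End Branch.

(** * Regrouping all partitions by the index [k] *)

Section Total.
Variables (F : fieldType) (q : F).
Hypothesis hq : forall i : nat, (0 < i)%N -> q ^+ i != 1.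

Lemma leq_tri n : (n <= tri n)%N.
Proof. by rewrite /tri -{1}(bin1 n) binS leq_addl. Qed.

Lemma sum_eq_ord (N i : nat) (G : nat -> F) : (i < N)%N ->
  \sum_(j < N) (j == i :> nat)%:R * G j = G i.
Proof.
move=> iN; rewrite (bigD1 (Ordinal iN)) //= eqxx mul1r big1 ?addr0 // => j ji.
by rewrite [(j == i :> nat)%N](negbTE (ji : j != i :> nat)) mul0r.
Qed.

(** Splits the sum by [s = e - o] and by [w]. As [s + 2 w <= 3 n < m], the length [m] is large
    enough for [refined_sumE]. *)
Lemma first_sum_core n m d : (d <= n)%N -> (3 * n < m)%N ->
  first_sum q m d (fun e o => (tri d + e + o == n)%N%:R) =
  \sum_(s < d.+1) \sum_(w < n.+1)
    (2 * w + tri (core_index d s) == n)%N%:R * refined_sum q d s w.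
Proof.
move=> dn nm; pose ind s w e o : F := ((e == s + o) && (s * (d.+1 - s) + o == w))%N%:R.
transitivity (first_sum q m d (fun e o => \sum_(s < d.+1) \sum_(w < n.+1)
    (2 * w + tri (core_index d s) == n)%N%:R * ind s w e o)).
  apply: eq_first_sum => e o eo; have sd : (e - o <= d)%N by lia.
  pose w s := (s * (d.+1 - s) + o)%N.
  pose g s : F := (2 * w s + tri (core_index d s) == n)%N%:R.
  transitivity (\sum_(s < d.+1) (s == e - o :> nat)%N%:R * g s).
    rewrite (sum_eq_ord g) // /g /w; congr ((_ : bool)%:R).
    by have := tri_core_index sd; lia.
  apply: eq_bigr => s _; have -> : (s == e - o :> nat)%N = (e == s + o)%N by lia.
  rewrite /ind; case: (e == s + o)%N => /=; last first.
    by rewrite mul0r big1 // => w' _; rewrite mulr0.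
  rewrite mul1r; case: (leqP (w s) n) => wn.
    rewrite /g -(@sum_eq_ord n.+1 (w s) (fun w' => (2 * w' + tri (core_index d s) == n)%N%:R)) //.
    by apply: eq_bigr => w' _; rewrite mulrC; congr (_ * (_ : bool)%:R); rewrite eq_sym.
  rewrite /g big1 => [|w' _]; first by case: eqP => //; lia.
  case: eqP => [|_]; last by rewrite mul0r.
  by rewrite -/(w s); case: eqP; rewrite ?mulr0 //; have := ltn_ord w'; lia.
rewrite /first_sum.
under eq_bigr => b _.
  rewrite (tail_sum_big _ _ _ _ _ (fun (s : 'I_d.+1) u v => \sum_(w < n.+1)
    (2 * w + tri (core_index d s) == n)%N%:R * ind s w (b + v)%N u)).
  under eq_bigr => s _.
    rewrite (tail_sum_big _ _ _ _ _ (fun (w : 'I_n.+1) u v =>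
      (2 * w + tri (core_index d s) == n)%N%:R * ind s w (b + v)%N u)).
    under eq_bigr => w _ do rewrite (tail_sumZ _ _ _ _ _ (fun u v => ind s w (b + v)%N u)).
    over.
  over.
rewrite exchange_big /=; apply: eq_bigr => s _.
rewrite exchange_big /=; apply: eq_bigr => w _.
rewrite -mulr_sumr -(@refined_sumE _ _ hq m) //.
by have := ltn_ord s; have := ltn_ord w; lia.
Qed.

(** Grouping the pairs [(d, s)] by [k = core_index d s] turns the inner sums into [core_sum k w],
    which [core_sumE] frees of [k]. *)
Lemma first_sum_total n m : (3 * n < m)%N ->
  \sum_(d < n.+1) first_sum q m d (fun e o => (tri d + e + o == n)%N%:R) =
  \sum_(k < n.+1) \sum_(w < n.+1)
    (2 * w + tri k == n)%N%:R * refined_sum q w 0 w.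
Proof.
move=> nm; pose X d s := \sum_(w < n.+1)
    (2 * w + tri (core_index d s) == n)%N%:R * refined_sum q d s w.
transitivity (\sum_(d < n.+1) \sum_(s < d.+1) X d s).
  by apply: eq_bigr => d _; rewrite (first_sum_core (n := n)) // -ltnS.
rewrite sum_core_index => [|d s nd sd]; last first.
  rewrite /X big1 // => w _; case: (leqP (s * (d.+1 - s)) w) => sw.
    have := tri_core_index sd; have := leq_tri d.
    by case: eqP => [|_]; rewrite ?mul0r //; lia.
  by rewrite refined_sum_eq0 ?mulr0 // sw orbT.
apply: eq_bigr => k _; rewrite /X.
under eq_bigr => r _.
  rewrite -big_split /=.
  have -> : core_index (k + 2 * r) r = k by rewrite /core_index leq_addl addnK.
  have -> : core_index (k + 2 * r).+1 (k + r).+1 = k.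
    by rewrite /core_index ifF; lia.
  under eq_bigr => w _ do rewrite -mulrDr.
  over.
rewrite exchange_big /=; apply: eq_bigr => w _.
by rewrite -mulr_sumr (core_sum_widen _ _ (ltn_ord w)) core_sumE.
Qed.

End Total.

(** * Gauss' triangular series *)
Section Gauss.
Variables (R : comUnitRingType) (X : R).
Hypothesis U : forall k, 1 - X ^+ k.+1 \is a GRing.unit.

Definition gauss_factor i : R := (1 - X ^+ (2 * i)) / (1 - X ^+ (2 * i - 1)).

(** The term [s = 0] is the partial product of Gauss' identity; for [s > 0] the power of [X] is at
    least [2 n + 1]. *)
Definition gauss_term n s : R :=
  X ^+ (s * (2 * n + 1)) * \prod_(s.+1 <= i < n.+1) gauss_factor i.

(* Shanks' telescoping proof of Gauss' identity for triangular exponents. *)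
Lemma gauss_shanks n :
  \sum_(s < n.+1) gauss_term n s = \sum_(k < (2 * n).+1) X ^+ tri k.
Proof.
elim: n => [|n IHn].
  by rewrite !big_ord1 /gauss_term big_geq // mul0n mulr1.
(* For [s < n], the difference [H s.+1 - H s] is $1 - X^{2n+1}$ times
   [gauss_term n.+1 s - gauss_term n s]. *)
pose H s := (1 - X ^+ (2 * s)) * gauss_term n s.
have stepS s : (s <= n)%N -> gauss_term n.+1 s * (1 - X ^+ (2 * n).+1) =
    X ^+ (2 * s) * (1 - X ^+ (2 * n.+1)) * gauss_term n s.
  move=> sn; rewrite /gauss_term big_nat_recr //= /gauss_factor.
  have -> : (2 * n.+1 - 1 = (2 * n).+1)%N by lia.
  have -> : (s * (2 * n.+1 + 1) = s * (2 * n + 1) + 2 * s)%N by lia.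
  rewrite exprD -!mulrA mulVr ?U // mulr1; ring.
have stepH s : (s < n)%N -> H s.+1 = X ^+ (2 * n).+1 * (1 - X ^+ (2 * s).+1) * gauss_term n s.
  move=> sn; rewrite /H /gauss_term [in RHS]big_ltn ?ltnS // /gauss_factor.
  have -> : (2 * s.+1 - 1 = (2 * s).+1)%N by lia.
  have -> : (s.+1 * (2 * n + 1) = s * (2 * n + 1) + (2 * n).+1)%N by lia.
  rewrite exprD; set a := _ - X ^+ (2 * s.+1); set b := 1 - X ^+ (2 * s).+1.
  transitivity (X ^+ (2 * n).+1 * X ^+ (s * (2 * n + 1)) * (b / b) * a *
    \prod_(s.+2 <= i < n.+1) gauss_factor i); last by ring.
  by rewrite divrr ?U // mulr1; ring.
have main : (1 - X ^+ (2 * n).+1) * \sum_(s < n.+1) (gauss_term n.+1 s - gauss_term n s) =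
    X ^+ tri (2 * n).+1 * (1 - X ^+ (2 * n).+1).
  transitivity (\sum_(0 <= s < n) (H s.+1 - H s) +
     (1 - X ^+ (2 * n).+1) * (gauss_term n.+1 n - gauss_term n n)).
    rewrite mulr_sumr big_ord_recr /= big_mkord; congr (_ + _).
    apply: eq_bigr => s _; have sn := ltn_ord s.
    rewrite mulrBr [_ * gauss_term n.+1 s]mulrC stepS ?(ltnW sn) // stepH // /H.
    have -> : X ^+ (2 * n.+1) = X ^+ (2 * n).+1 * X by rewrite -exprSr; congr (_ ^+ _); lia.
    by rewrite [X ^+ (2 * s).+1]exprSr; ring.
  rewrite telescope_sumr // /H muln0 expr0 subrr mul0r subr0.
  rewrite mulrBr [_ * gauss_term n.+1 n]mulrC stepS //.
  rewrite {1 2 3}/gauss_term big_geq // mulr1.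
  have -> : tri (2 * n).+1 = (n * (2 * n + 1) + (2 * n).+1)%N.
    by have := mul2_tri (2 * n).+1; nia.
  have -> : X ^+ (2 * n.+1) = X ^+ (2 * n) * X * X by rewrite -!exprSr; congr (_ ^+ _); lia.
  rewrite exprD [X ^+ (2 * n).+1]exprSr; ring.
have last : gauss_term n.+1 n.+1 = X ^+ tri (2 * n.+1).
  rewrite /gauss_term big_geq // mulr1; congr (_ ^+ _).
  by have := mul2_tri (2 * n.+1); nia.
have -> : (2 * n.+1).+1 = (2 * n).+3 by lia.
rewrite big_ord_recr /= last 2![in RHS]big_ord_recr /= -IHn.
have -> : (2 * n).+2 = (2 * n.+1)%N by lia.
congr (_ + _); apply/eqP; rewrite addrC -subr_eq -sumrB; apply/eqP.
by apply: (mulrI (U (2 * n)%N)); rewrite main mulrC.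
Qed.

End Gauss.

(** * The generating series for [k >= w] *)
Section Diagonal.
Variables (F : fieldType) (q : F).
Hypothesis hq : forall i : nat, (0 < i)%N -> q ^+ i != 1.

Implicit Types phi : nat -> F.

(** As the $c_i$ weakly decrease, [u == v] forces $c_1 = c_2$, $c_3 = c_4$, and so on. *)
Definition diag_sum L p phi : F :=
  tail_sum q L.*2 p p (fun u v => if u == v then phi v else 0).

Lemma eq_diag_sum L p phi phi' : phi =1 phi' -> diag_sum L p phi = diag_sum L p phi'.
Proof. by move=> /funext->. Qed.

Lemma diag_sum_eq0 L p phi : phi =1 (fun=> 0) -> diag_sum L p phi = 0.
Proof. by move=> h; apply: tail_sum_eq0 => u v _; rewrite h if_same. Qed.

(** Here [f <= g] and [v <= u], so [g + u = f + v] only if [f = g] and [u = v]. *)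
Lemma diag_sum_collapse L g (h : nat -> F) phi :
  \sum_(f < g.+1) h f *
    tail_sum q L.*2 g f (fun u v => if (g + u == f + v)%N then phi (f + v)%N else 0) =
  h g * diag_sum L g (fun v => phi (g + v)%N).
Proof.
rewrite big_ord_recr big1 /= => [|f _].
  by rewrite add0r; congr (_ * _); apply: eq_tail_sum => u v _; rewrite eqn_add2l.
rewrite tail_sum_eq0 ?mulr0 // => u v uv; rewrite ifF //.
by have := ltn_ord f; lia.
Qed.

Lemma diag_sumS L p phi :
  diag_sum L.+1 p phi =
  \sum_(f < p.+1) qbinom q (p - f).+1 (p - f) * diag_sum L f (fun v => phi (f + v)%N).
Proof.
rewrite /diag_sum doubleS tail_sumS; apply: eq_bigr => g _; congr (_ * _).
rewrite tail_sumS (diag_sum_collapse L g (fun f => qbinom q (p - f).+1 (g - f))).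
by rewrite subnn qbinom_n0 // mul1r.
Qed.

(** For [s = 0] the parts pair up as $l_2 = l_3$, $l_4 = l_5$, and so on; the factor of the largest
    part [w] then has lower entry 0, so it is 1. *)
Lemma refined_sum_diag L w : (w <= L)%N ->
  refined_sum q w 0 w = \sum_(g < w.+1) diag_sum L g (fun v => (g + v == w)%N%:R).
Proof.
move=> wL; rewrite -(@refined_sumE _ _ hq L.*2.+1); last by lia.
apply: eq_bigr => g _; rewrite tail_sumS.
have := diag_sum_collapse L g (fun f => qbinom q (w - f).+1 (g - f)) (fun v => (v == w)%N%:R).
rewrite subnn qbinom_n0 // mul1r => <-.
apply: eq_bigr => f _; congr (_ * _); apply: eq_tail_sum => u v _.
by rewrite mul0n !add0n; case: eqP.
Qed.

(** The series $\sum_m h(m) t^{cm}$. *)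
Definition dilate c (h : nat -> F) : fps F :=
  Fps (fun n => if (c %| n)%N then h (n %/ c)%N else 0).

Lemma mul_dilate c a h : (0 < c)%N ->
  (1 - fpsC a * fpsX ^+ c) * dilate c h =
  dilate c (fun m => h m - (if m is m'.+1 then a * h m' else 0)).
Proof.
move=> c0; apply: fpsP => n.
rewrite mulrBl mul1r -mulrA fcoefD fcoefN fcoef_mulC fcoef_mulXn /=.
case: ltnP => nc.
  by rewrite mulr0 divn_small // !subr0.
move: nc => /subnK <-; rewrite addnK dvdn_addl // divnDr // divnn c0 addn1.
by case: ifP; rewrite ?mulr0 ?subr0.
Qed.

(** [qbinom q m.+1 m] is $1 + q + \dots + q^m$, with generating series $1/((1-x)(1-qx))$ in $x =
    t^c$. *)
Lemma dilate_qbinom c : (0 < c)%N ->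
  (1 - fpsX ^+ c) * (1 - fpsC q * fpsX ^+ c) * dilate c (fun m => qbinom q m.+1 m) = 1.
Proof.
move=> c0; rewrite -mulrA mul_dilate // -[fpsX ^+ c in X in X * _]mul1r.
rewrite (mul_dilate 1 _ c0); apply: fpsP => n; rewrite fcoef1 /=.
have E m : qbinom q m.+1 m - (if m is m'.+1 then q * qbinom q m'.+1 m' else 0) = 1.
  case: m => [|m]; first by rewrite qbinom_n0 // subr0.
  rewrite !qbinomE // !subSnn !(qfactS q m.+1) !(qfactS q m) !(qfactS q 0) qfact0.
  have := (subqX_neq0 hq m, subqX_neq0 hq m.+1, subqX_neq0 hq 0, qfact_neq0 hq m).
  rewrite !exprS expr0 mulr1 => -[[[n1 n2] n3] n4].
  by field; rewrite n3 n4 n1.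
case: (boolP (c %| n)%N) => [/dvdnP[m ->]|]; last by case: n => //; rewrite dvdn0.
rewrite mulnK // E muln_eq0 [c == 0%N]gtn_eqF // orbF.
by case: m => [|m]; rewrite ?subr0 // E mul1r subrr.
Qed.

Definition diag_series L j : fps F :=
  Fps (fun n => \sum_(p < n.+1) diag_sum L p (fun v => (2 * (j * p + v) == n)%N%:R)).

Lemma diag_series_widen L j n N : (0 < j)%N -> (n <= N)%N ->
  fcoef (diag_series L j) n =
  \sum_(p < N.+1) diag_sum L p (fun v => (2 * (j * p + v) == n)%N%:R).
Proof.
move=> j0 nN; pose G p := diag_sum L p (fun v => (2 * (j * p + v) == n)%N%:R).
rewrite -[RHS](big_mkord xpredT G) (big_cat_nat (n := n.+1)) //= big_mkord.
rewrite [X in _ + X]big_nat [X in _ + X]big1 ?addr0 // => p /andP[np _].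
by apply: diag_sum_eq0 => v; case: eqP => //; nia.
Qed.

(** With [m = p - f], [j p + f = j m + (j + 1) f]: the sum over [m] splits off, and [f] is left with
    multiplicity [j + 1]. *)
Lemma diag_seriesS L j : (0 < j)%N ->
  diag_series L.+1 j = dilate (2 * j) (fun m => qbinom q m.+1 m) * diag_series L j.+1.
Proof.
move=> j0; apply: fpsP => n; rewrite fcoefM.
pose T m f := qbinom q m.+1 m *
  diag_sum L f (fun v => (2 * (j.+1 * f + v) + 2 * j * m == n)%N%:R).
transitivity (\sum_(f < n.+1) \sum_(m < n.+1) T m f).
  transitivity (\sum_(f < n.+1) \sum_(m < (n - f).+1) T m f).
    rewrite /=; under eq_bigr => p _ do rewrite diag_sumS.
    rewrite (sum_ord_triangle (fun p f => qbinom q (p - f).+1 (p - f) *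
      diag_sum L f (fun v => (2 * (j * p + (f + v)) == n)%N%:R))).
    apply: eq_bigr => f _; apply: eq_bigr => m _; rewrite /T addKn; congr (_ * _).
    by apply: eq_diag_sum => v; congr ((_ : bool)%:R); lia.
  apply: eq_bigr => f _; rewrite -!(big_mkord xpredT (T^~ f)).
  rewrite [in RHS](big_cat_nat (n := (n - f).+1)) //=; last by lia.
  rewrite [X in _ = _ + X]big_nat [X in _ = _ + X]big1 ?addr0 // => m /andP[fm _].
  rewrite /T diag_sum_eq0 ?mulr0 // => v; case: eqP => //; nia.
rewrite exchange_big.
pose h m := qbinom q m.+1 m.
transitivity (\sum_(i < n.+1) \sum_(m < n.+1)
    (2 * j * m == i)%N%:R * (h m * fcoef (diag_series L j.+1) (n - i))).
  rewrite [RHS]exchange_big /=; apply: eq_bigr => m _.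
  rewrite /T -mulr_sumr; case: (leqP (2 * j * m) n) => jm; last first.
    rewrite big1 ?mulr0 => [|f _]; last first.
      by apply: diag_sum_eq0 => v; case: eqP => //; lia.
    by rewrite big1 // => i _; case: eqP; rewrite ?mul0r //; have := ltn_ord i; lia.
  under eq_bigr => i _ do rewrite eq_sym.
  rewrite (@sum_eq_ord _ _ _ (fun i => h m * fcoef (diag_series L j.+1) (n - i))) //.
  rewrite (diag_series_widen _ _ (leq_subr _ n)) //; congr (_ * _).
  apply: eq_bigr => f _; apply: eq_diag_sum => v; congr ((_ : bool)%:R); lia.
apply: eq_bigr => i _; rewrite [fcoef (dilate _ _) i]/=.
case: (boolP (2 * j %| i)%N) => [/dvdnP[m im]|ji].
  have mn : (m < n.+1)%N by have := ltn_ord i; nia.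
  rewrite im mulnK ?muln_gt0 //.
  rewrite -(@sum_eq_ord _ _ _ (fun m' => h m' * fcoef (diag_series L j.+1) (n - m * (2 * j))) mn).
  apply: eq_bigr => m' _; congr ((_ : bool)%:R * _).
  by rewrite mulnC eqn_pmul2r // muln_gt0.
rewrite mul0r big1 // => m _; case: eqP => [e|_]; last by rewrite mul0r.
by rewrite -e dvdn_mulr in ji.
Qed.

Lemma diag_seriesE L j : (0 < j)%N ->
  diag_series L j =
  \prod_(j <= i < j + L)
     ((1 - fpsX ^+ (2 * i)) * (1 - fpsC q * fpsX ^+ (2 * i)))^-1.
Proof.
elim: L j => [|L IHL] j j0.
  rewrite addn0 big_geq //; apply: fpsP => n.
  rewrite fcoef1 /= big_ord_recl big1 => [|p _]; last first.
    by rewrite /diag_sum /= mul0r.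
  by rewrite /diag_sum /= mul1r muln0 addr0 eq_sym.
rewrite diag_seriesS // IHL // addSnnS [RHS]big_ltn; last by lia.
congr (_ * _); have j2 : (0 < 2 * j)%N by rewrite muln_gt0.
have U : (1 - fpsX ^+ (2 * j)) * (1 - fpsC q * fpsX ^+ (2 * j)) \is a GRing.unit.
  by rewrite unitrM fps_unit_sub_Xn // fps_unit_sub_CXn.
by apply: (mulrI U); rewrite dilate_qbinom // divrr.
Qed.

Lemma fcoef_diag_series L n i : (i <= n)%N -> (n <= L)%N ->
  fcoef (diag_series L 1) i =
  \sum_(w < n.+1) (2 * w == i)%N%:R * refined_sum q w 0 w.
Proof.
move=> le_in nL; case: (boolP (2 %| i)%N) => [/dvdnP[w iw] | odd_i]; last first.
  rewrite /= !big1 // => [w _|p _].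
    by case: eqP => [e|_]; rewrite ?mul0r //; rewrite -e dvdn_mulr in odd_i.
  apply: diag_sum_eq0 => v; case: eqP => [e|//].
  by rewrite -e dvdn_mulr in odd_i.
have wn : (w < n.+1)%N by lia.
rewrite (eq_bigr (fun w' : 'I_n.+1 => (w' == w :> nat)%:R * refined_sum q w' 0 w')); last first.
  by move=> w' _; congr ((_ : bool)%:R * _); lia.
rewrite (@sum_eq_ord _ _ _ (fun w => refined_sum q w 0 w)) //.
rewrite (refined_sum_diag (L := L)); last by lia.
pose G p := diag_sum L p (fun v => (p + v == w)%N%:R).
rewrite /= -[RHS](big_mkord xpredT G).
transitivity (\sum_(p < i.+1) G p).
  apply: eq_bigr => p _; apply: eq_diag_sum => v; congr ((_ : bool)%:R); lia.
rewrite -(big_mkord xpredT G) (big_cat_nat (n := w.+1)) //=; last by lia.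
rewrite [X in _ + X]big_nat [X in _ + X]big1 ?addr0 // => p /andP[wp _].
by apply: diag_sum_eq0 => v; case: eqP => //; lia.
Qed.

End Diagonal.

(** * Enumeration of partitions *)
Fixpoint part_seqs m M : seq (seq nat) :=
  [::] :: if m is m'.+1 then [seq a :: l | a <- iota 1 M, l <- part_seqs m' a]
          else [::].

Lemma is_intpart_cons a l :
  is_intpart (a :: l) = [&& (0 < a)%N, (head 0%N l <= a)%N & is_intpart l].
Proof.
rewrite /is_intpart inE negb_or lt0n eq_sym andbCA; congr (_ && _).
case: l => [|b l] /=; first by [].
by rewrite -andbA.
Qed.

Lemma mem_part_seqs m M l :
  (l \in part_seqs m M) = [&& is_intpart l, (size l <= m)%N & (head 0%N l <= M)%N].
Proof.
elim: m M l => [|m IHm] M l; first by rewrite /= inE; case: l => // a l; rewrite andbF.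
case: l => [|a l]; first by rewrite inE.
rewrite /= inE /= is_intpart_cons ltnS; apply/allpairsPdep/idP.
  case=> b [l' [bM l'b [-> ->]]].
  move: bM l'b; rewrite mem_iota IHm => ? /and3P[? ? ?]; apply/and3P; split => //; last lia.
  by apply/and3P; split => //; lia.
case/and3P => /and3P[a0 la il] lm aM; exists a, l; split => //.
  by rewrite mem_iota; lia.
by rewrite IHm il lm la.
Qed.

Lemma uniq_part_seqs m M : uniq (part_seqs m M).
Proof.
elim: m M => [|m IHm] M //=; apply/andP; split.
  by apply/negP => /allpairsPdep[a [l [_ _]]].
apply: allpairs_uniq_dep => [|a _|]; rewrite ?iota_uniq ?IHm //.
by move=> [a l] [a' l'] _ _ /= [-> ->].
Qed.

Lemma big_part_seqsS (R : nmodType) m M (G : seq nat -> R) :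
  \sum_(l <- part_seqs m.+1 M) G l =
  G [::] + \sum_(a < M) \sum_(l <- part_seqs m a.+1) G (a.+1 :: l).
Proof.
rewrite big_cons /= big_allpairs_dep /= -[1%N]addn0 iotaDl big_map.
by rewrite -{1}[M]subn0 -/(index_iota 0 M) big_mkord.
Qed.

(* The sums of [l_1 + l_3 + ...] and [l_2 + l_4 + ...]. *)
Fixpoint alt_sums (l : seq nat) : nat * nat :=
  if l is a :: l' then ((a + (alt_sums l').2)%N, (alt_sums l').1) else (0, 0)%N.

Lemma sumn_alt_sums l : sumn l = ((alt_sums l).1 + (alt_sums l).2)%N.
Proof. by elim: l => //= a l ->; lia. Qed.

Section Partitions.
Variables (F : fieldType) (q : F).
Hypothesis hq : forall i : nat, (0 < i)%N -> q ^+ i != 1.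

Fixpoint tail_prod d l : F :=
  if l is b :: l' then
    qbinom q (d - head 0%N l').+1 (b - head 0%N l') * tail_prod b l'
  else 1.

Definition seq_prod l : F := if l is d :: l' then tail_prod d l' else 1.

Lemma part_prod_seq (l : intpart) : part_prod q l = seq_prod l.
Proof.
rewrite /part_prod /part_factor /part; case: l => -[|d l] _ /=; first by rewrite big_geq.
elim: l d => [|b l IHl] d /=.
  by rewrite big_nat1 /= !subn0 qbinom_n0.
rewrite big_ltn // -[2%N]/(1 + 1)%N big_addn subn1 /= -(IHl b) addn1; congr (_ * _).
by apply: eq_big_nat => i /andP[i1 _]; rewrite [(i + 1)%N]addn1; case: i i1.
Qed.

(** Dropping trailing zeros turns the chains of [tail_sum] into partitions; by [tail_sum_b0] the
    zeros contribute only factors 1. *)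
Lemma tail_sum_part_seqs m a b (phi : nat -> nat -> F) :
  tail_sum q m.+1 a b phi =
  \sum_(l <- part_seqs m b)
    tail_prod a (b :: l) * phi (alt_sums l).1 (alt_sums l).2.
Proof.
elim: m a b phi => [|m IHm] a b phi.
  rewrite tail_sumS big_ord_recl big1 => [|c _]; last by rewrite /= mul0r mulr0.
  by rewrite big_cons big_nil /= !addr0 mul1r mulr1.
rewrite tail_sumS big_part_seqsS big_ord_recl tail_sum_b0 //.
congr (_ + _); first by rewrite /= mulr1.
apply: eq_bigr => c _; rewrite lift0 IHm mulr_sumr.
by apply: eq_bigr => l _; rewrite /= mulrA.
Qed.

Lemma first_sum_part_seqs m d (chi : nat -> nat -> F) :
  first_sum q m.+1 d chi =
  \sum_(l <- part_seqs m.+1 d) tail_prod d l * chi (alt_sums l).1 (alt_sums l).2.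
Proof.
rewrite big_part_seqsS /first_sum big_ord_recl tail_sum_b0 //.
congr (_ + _); first by rewrite /= mul1r.
by apply: eq_bigr => b _; rewrite lift0 tail_sum_part_seqs.
Qed.

Definition exponent (l : seq nat) :=
  ((nth 0 l 0 * (nth 0 l 0 - 1)) %/ 2 + sumn l)%N.

Lemma exponentE d l :
  exponent (d :: l) = (tri d + (alt_sums l).1 + (alt_sums l).2)%N.
Proof.
rewrite /exponent /= sumn_alt_sums.
have -> : ((d * (d - 1)) %/ 2 = 'C(d, 2))%N by rewrite bin2 divn2 subn1.
by rewrite /tri binS bin1; lia.
Qed.

Lemma big_part_seqs_first_sum m n M :
  \sum_(l <- part_seqs m.+2 M) seq_prod l * (exponent l == n)%:R =
  \sum_(d < M.+1) first_sum q m.+1 d (fun e o => (tri d + e + o == n)%N%:R).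
Proof.
rewrite big_part_seqsS big_ord_recl; congr (_ + _).
  by rewrite first_sum_part_seqs big_part_seqsS big_ord0 addr0 /= !mul1r.
apply: eq_bigr => d _; rewrite first_sum_part_seqs; apply: eq_bigr => l _.
by rewrite exponentE.
Qed.

End Partitions.

(** * Comparison of the sum and of the product with a common series *)

Lemma leq_size_sumn l : 0%N \notin l -> (size l <= sumn l)%N.
Proof.
elim: l => //= a l IHl; rewrite inE negb_or => /andP[a0 /IHl]; lia.
Qed.

Lemma fcoef_sum (R : comNzRingType) (I : Type) (r : seq I) (f : I -> fps R) n :
  fcoef (\sum_(i <- r) f i) n = \sum_(i <- r) fcoef (f i) n.
Proof.
by apply: (big_morph (fun g => fcoef g n)) => [g h|]; rewrite ?fcoefD ?fcoef0.
Qed.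

(** With $a = 1 - t^{2i-1}$, $b = 1 - t^{2i}$ and $c = 1 - q t^{2i}$, this splits the [i]-th factor
    of the product between [gauss_factor] and [diag_seriesE]. *)
Lemma div1_mul_cancel (R : comUnitRingType) (a b c : R) :
  a \is a GRing.unit -> b \is a GRing.unit -> c \is a GRing.unit ->
  1 / (a * c) = b / a * (b * c)^-1.
Proof.
move=> ua ub uc; rewrite mul1r !invrM //.
transitivity (b / b * (c^-1 * a^-1)); first by rewrite divrr // mul1r.
by ring.
Qed.

Section Main.
Variables (F : fieldType) (q : F).
Hypothesis hq : forall i : nat, (0 < i)%N -> q ^+ i != 1.

(** The product of $\sum_k t^{k(k+1)/2}$ and the series in $t^{2w}$ with coefficients
    [refined_sum q w 0 w]. *)
Definition total_series : fps F := Fps (fun n =>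
  \sum_(k < n.+1) \sum_(w < n.+1)
    (2 * w + tri k == n)%N%:R * refined_sum q w 0 w).

Lemma has_sum_total :
  fps_has_sum
    (fun l : intpart =>
       fpsC (part_prod q l) *
       fpsX ^+ ((part l 1 * (part l 1 - 1)) %/ 2 + weight l)%N) total_series.
Proof.
(* A partition with exponent [n] has weight at most [n], hence lies in [S]; the length [3 n + 2]
   leads to [first_sum_total] at [m = 3 n + 1]. *)
move=> n; pose S := part_seqs (3 * n).+2 n.
exists (seq_fset tt (pmap insub S)) => B AB.
rewrite /= -(@first_sum_total _ _ hq n (3 * n).+1) // -big_part_seqs_first_sum // -/S.
pose G l := seq_prod q l * (exponent l == n)%:R.
transitivity (\sum_(l <- map val (B : seq intpart)) G l).
  rewrite fcoef_sum big_map; apply: eq_bigr => l _.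
  rewrite fcoef_mulC -[fpsX ^+ _]mulr1 fcoef_mulXn part_prod_seq // fcoef1 /G.
  rewrite -/(exponent l); congr (_ * _); case: ltngtP => h.
  - by [].
  - by rewrite subn_eq0 leqNgt h.
  by rewrite h subnn.
have mk (s : seq (seq nat)) :
    \sum_(l <- s) G l = \sum_(l <- [seq l <- s | exponent l == n]) G l.
  rewrite big_filter [RHS]big_mkcond; apply: eq_bigr => l _.
  by rewrite /G; case: eqP; rewrite ?mulr0.
rewrite mk [RHS]mk; apply: perm_big; apply: uniq_perm.
- by rewrite filter_uniq // map_inj_uniq ?fset_uniq //; apply: val_inj.
- by rewrite filter_uniq // uniq_part_seqs.
move=> l; rewrite !mem_filter; case: eqP => //= ln; rewrite mem_part_seqs.
apply/mapP/and3P => [[p _ lp] | [il lm lM]].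
  have il : is_intpart l by rewrite lp; apply: valP.
  have ls : (sumn l <= n)%N by rewrite -ln leq_addl.
  split=> //; first by have := leq_size_sumn (andP il).2; lia.
  by move: ls; case: (l) => //= a l' ; lia.
exists (IntPart il) => //; apply: (fsubsetP AB); rewrite seq_fsetE mem_pmap.
apply/mapP; exists l; first by rewrite mem_part_seqs il lm.
by rewrite insubT.
Qed.

Lemma has_prod_total :
  fps_has_prod
    (fun i : nat =>
       1 / ((1 - fpsX ^+ (2 * i - 1)%N) * (1 - fpsC q * fpsX ^+ (2 * i)%N)))
    total_series.
Proof.
move=> n; exists n => M nM.
have U k : (1 - (@fpsX F) ^+ k.+1) \is a GRing.unit by apply: fps_unit_sub_Xn.
have -> : \prod_(1 <= i < M.+1)
    (1 / ((1 - fpsX ^+ (2 * i - 1)%N) * (1 - fpsC q * fpsX ^+ (2 * i)%N))) =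
    gauss_term fpsX M 0 * diag_series q M 1.
  rewrite diag_seriesE // add1n /gauss_term mul0n mul1r -big_split /=.
  apply: eq_big_nat => i /andP[i1 _]; rewrite /gauss_factor.
  have [k ->] : exists k, i = k.+1 by exists i.-1; rewrite prednK.
  have -> : (2 * k.+1 - 1 = (2 * k).+1)%N by lia.
  have -> : (2 * k.+1 = (2 * k).+2)%N by lia.
  have Uq := @fps_unit_sub_CXn F q (2 * k).+2 isT.
  by apply: div1_mul_cancel; rewrite ?U.
have nM2 : (n < 2 * M + 1)%N by lia.
(* The added terms [s > 0] are divisible by [fpsX ^+ (2 * M + 1)], so coefficient [n] does not
   change; [gauss_shanks] then evaluates the full sum. *)
transitivity (fcoef ((\sum_(s < M.+1) gauss_term fpsX M s) * diag_series q M 1) n).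
  rewrite big_ord_recl mulrDl fcoefD mulr_suml fcoef_sum big1 ?addr0 // => s _.
  by rewrite /gauss_term lift0 -mulrA fcoef_mulXn ifT //; nia.
rewrite gauss_shanks // mulr_suml fcoef_sum.
pose T k := \sum_(w < n.+1) (2 * w + tri k == n)%N%:R * refined_sum q w 0 w.
rewrite -[RHS]/(\sum_(k < n.+1) T k); transitivity (\sum_(k < (2 * M).+1) T k).
  apply: eq_bigr => k _; rewrite fcoef_mulXn /T; case: ltnP => kn.
    by rewrite big1 // => w _; case: eqP; rewrite ?mul0r //; lia.
  rewrite (@fcoef_diag_series _ _ hq M n) ?leq_subr //.
  by apply: eq_bigr => w _; congr ((_ : bool)%:R * _); lia.
rewrite -!(big_mkord xpredT T) (big_cat_nat (n := n.+1)) //=; last by lia.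
rewrite [X in _ + X]big_nat [X in _ + X]big1 ?addr0 // => k /andP[nk _].
rewrite /T big1 // => w _; have := leq_tri k.
by case: eqP; rewrite ?mul0r //; lia.
Qed.

End Main.

Theorem theorem1p3 (F : fieldType) (q : F)
    (hq : forall i : nat, (0 < i)%N -> q ^+ i != 1) :
  exists s : fps F,
    fps_has_sum
      (fun l : intpart =>
         fpsC (part_prod q l) *
         fpsX ^+ ((part l 1 * (part l 1 - 1)) %/ 2 + weight l)%N) s /\
    fps_has_prod
      (fun i : nat =>
         1 / ((1 - fpsX ^+ (2 * i - 1)%N) * (1 - fpsC q * fpsX ^+ (2 * i)%N))) s.
Proof.
by exists (total_series q); split; [apply: has_sum_total | apply: has_prod_total].
Qed.
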